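(* Let $n$ be a positive integer and let $A_1, A_2$ be sets of integers such that both are MSTD, $A_1$ is $P_n$ and $A_2$ is $P_{n-4}$. Suppose also that: (1) $A_1\cap A_2=\emptyset$ and $A_1\cup A_2=[1,2n]$; (2) $A_i=L_i\cup R_i$ with $L_i\subseteq[1,n]$ and $R_i\subseteq[n+1,2n]$ for $i=1,2$; (3) $[1,4]\cup\{n\}\subseteq L_1$ and $\{n+1\}\cup[2n-3,2n]\subseteq R_1$; (4) $[5,7]\subseteq L_2$ and $[2n-6,2n-4]\subseteq R_2$. Pick an integer $k\ge n/2+2$ and an integer $m\ge 0$. Set $R_1'=R_1+m+4k+4$, $R_2'=R_2+m+4k+4$, $O_{11}=\{n+4\}\cup[n+5,n+2k+1]_2\cup\{n+2k+2\}$, $O_{12}=\{n+m+2k+3\}\cup[n+m+2k+4,n+m+4k]_2\cup\{n+m+4k+1\}$, $O_{21}=[n+1,n+3]\cup[n+6,n+2k]_2\cup[n+2k+3,n+2k+5]$, $O_{22}=[n+m+2k,n+m+2k+2]\cup[n+m+2k+5,n+m+4k-1]_2\cup[n+m+4k+2,n+m+4k+4]$. Let $M_1\subseteq[n+2k+6,n+m+2k-1]$ be such that within $M_1$ there exists a sequence of pairs of consecutive integers $\{x_1,x_1+1\},\dots,\{x_t,x_t+1\}\subseteq M_1$ with $x_1<\dots<x_t$, where consecutive pairs in the sequence are not more than $2k-1$ apart (i.e. $x_{j+1}-x_j\le 2k-1$), the first pair lies in $[n+2k+6,n+4k+1]$ and the last pair lies in $[n+m+4,n+m+2k-1]$. Let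 $M_2\subseteq[n+2k+6,n+m+2k-1]$ be such that within $M_2$ there exists a sequence of triplets of consecutive integers $\{y_1,y_1+1,y_1+2\},\dots,\{y_s,y_s+1,y_s+2\}\subseteq M_2$ with $y_1<\dots<y_s$, where consecutive triplets in the sequence are not more than $2k+5$ apart (i.e. $y_{j+1}-y_j\le 2k+5$), the first triplet lies in $[n+2k+6,n+4k+5]$ and the last triplet lies in $[n+m,n+m+2k-1]$. Suppose moreover $M_1\cap M_2=\emptyset$ and $M_1\cup M_2=[n+2k+6,n+m+2k-1]$. Then $A_1'=L_1\cup O_{11}\cup M_1\cup O_{12}\cup R_1'$ and $A_2'=L_2\cup O_{21}\cup M_2\cup O_{22}\cup R_2'$ are both MSTD and they partition $[1,2n+m+4k+4]$.
   Context: For integers $a\le b$, $[a,b]=\{\ell\in\mathbb{Z}: a\le\ell\le b\}$ and $[a,b]_2=\{\ell\in\mathbb{Z}: a\le \ell\le b,\ \ell-a \text{ even}\}$. For a set $A$ of integers, $A+A=\{x+y:x,y\in A\}$, $A-A=\{x-y:x,y\in A\}$, and $A+t=\{x+t:x\in A\}$. A finite set $A$ is MSTD (more-sums-than-differences) if $|A+A|>|A-A|$. A finite set $A$ with $a=\min A$, $b=\max A$ is $P_n$ if $A+A\supseteq[2a+n,2b-n]$ and $A-A\supseteq[(a-b)+n,(b-a)-n]$. *)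

(* Defs.v *)
From HB Require Import structures.
From mathcomp Require Export all_boot all_order all_algebra.
From mathcomp Require Export finmap.
Set Implicit Arguments.
Unset Strict Implicit.
Unset Printing Implicit Defensive.
Export Order.TTheory GRing.Theory Num.Theory.

Local Open Scope fset_scope.
Local Open Scope ring_scope.

(* The integer interval [a, b]; it is empty when b < a. *)
Definition zint (a b : int) : {fset int} :=
  if a <= b then [fset a + i%:Z | i in iota 0 `|b - a|.+1] else fset0.

Lemma in_zint (a b x : int) : (x \in zint a b) = (a <= x <= b).
Proof.
have mem_i n (i : nat) : (i \in iota 0 n) = (i < n)%N by rewrite mem_iota.
rewrite /zint; case: ifP => [leab | /negbT nleab].
  apply/imfsetP/idP => [[i lei ->] | /andP[lax lxb]].
    have {}lei : (i <= `|b - a|)%N by rewrite -ltnS -mem_i.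
    by rewrite lerDl lez_nat /= -lerBrDl -[b - a]gez0_abs ?subr_ge0 // lez_nat.
  exists `|x - a|%N; last by rewrite gez0_abs ?subr_ge0 // subrKC.
  change (`|x - a|%N \in iota 0 `|b - a|.+1).
  by rewrite mem_i ltnS -lez_nat !gez0_abs ?subr_ge0 // lerD2r.
rewrite inE; apply/esym/negbTE; apply: contra nleab => /andP[].
exact: le_trans.
Qed.

(* [a, b]_2 *)
Definition zint2 (a b : int) : {fset int} :=
  [fset x in zint a b | (2 %| x - a)%Z].

Definition sumset (A : {fset int}) : {fset int} :=
  [fset x + y | x in A, y in A].

Definition diffset (A : {fset int}) : {fset int} :=
  [fset x - y | x in A, y in A].

Definition translate (t : int) (A : {fset int}) : {fset int} :=
  [fset x + t | x in A].

Definition MSTD (A : {fset int}) : Prop := (#|` diffset A| < #|` sumset A|)%N.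

Definition is_min (A : {fset int}) (a : int) : Prop :=
  a \in A /\ forall x, x \in A -> a <= x.

Definition is_max (A : {fset int}) (b : int) : Prop :=
  b \in A /\ forall x, x \in A -> x <= b.

(* Having a minimum and a maximum, a set that is P_n is nonempty. *)
Definition isP (n : int) (A : {fset int}) : Prop :=
  exists a b : int,
    [/\ is_min A a, is_max A b,
        zint (2 * a + n) (2 * b - n) `<=` sumset A &
        zint ((a - b) + n) ((b - a) - n) `<=` diffset A].

(* l = 2 gives pairs and l = 3 triplets. *)
Definition run (l x : int) : {fset int} := zint x (x + l - 1).

(* The runs of l consecutive integers starting at x :: s (x_1 = x, ...) are all
   contained in M, the starting points increase strictly by at most d, the first
   run is contained in I and the last one in J. The sequence is nonempty. *)
Definition has_run_chain (l d : int) (M I J : {fset int}) : Prop :=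
  exists (x : int) (s : seq int),
    [/\ forall y, y \in x :: s -> run l y `<=` M,
        path (fun u v => (u < v) && (v - u <= d)) x s,
        run l x `<=` I & run l (last x s) `<=` J].

(* Main.v *)
(* Write N = 2n + t with t = m + 4k + 4, so that R_i' = R_i + t and the new sets
   lie in [1, N].  With a = 1 resp. a = 5 the minimum of A_i, the sums <= n + a
   or > 2N - n - a + 1 and the differences of absolute value > n - a + t of A_i'
   only use elements of L_i and R_i', hence correspond to sums and differences
   of A_i.  Since A_i - A_i contains [-(n - a), n - a], passing from A_i to
   A_i' adds at most 2t differences, and it adds at least 2t sums as soon as
   A_i' + A_i' contains the middle interval [n + a + 1, 2N - n - a + 1].  That inclusion is
   checked directly: up to N + 1 it follows from the sums of L_i + O_i1,
   O_i1 + O_i1, M_i + O_i1 and O_i1 + O_i2, where the translates of O_i1 by the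
   runs of M_i overlap because consecutive runs are close; the rest follows from
   the reflection x -> N + 1 - x, which preserves all the hypotheses used. *)
Require Import Defs.
From mathcomp Require Import zify lra.
Local Open Scope fset_scope.
Local Open Scope ring_scope.

(** * Membership in sumsets, difference sets and translates *)

(* Stated at type [int] and not at the choiceType over it, so that [lia]
   recognizes the bound variables. *)
Lemma fsubset_intP (A B : {fset int}) :
  reflect (forall x : int, x \in A -> x \in B) (A `<=` B).
Proof. exact: fsubsetP. Qed.

Lemma sumsetP (A : {fset int}) (z : int) :
  reflect (exists2 x : int, x \in A & (z - x : int) \in A) (z \in sumset A).
Proof.
apply: (iffP (imfset2P _ _ _ _ _)) => [[x xA [y yA ->]] | [x xA yA]].
  by exists x; rewrite // [x + y]addrC addrK.
by exists x => //; exists (z - x); rewrite ?subrKC.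
Qed.

Lemma diffsetP (A : {fset int}) (z : int) :
  reflect (exists2 y : int, y \in A & (z + y : int) \in A) (z \in diffset A).
Proof.
apply: (iffP (imfset2P _ _ _ _ _)) => [[x xA [y yA ->]] | [y yA xA]].
  by exists y; rewrite ?subrK.
by exists (z + y) => //; exists y; rewrite ?addrK.
Qed.

Lemma mem_zint2 (a b x : int) :
  (x \in zint2 a b) = (a <= x <= b) && (2 %| x - a)%Z.
Proof. by rewrite !inE in_zint. Qed.

Lemma mem_translate (t : int) (A : {fset int}) (x : int) :
  (x \in translate t A) = ((x - t : int) \in A).
Proof.
apply/imfsetP/idP => [[y yA ->] | xA]; first by rewrite addrK.
by exists (x - t); rewrite ?subrK.
Qed.

Lemma card_translate (t : int) (A : {fset int}) : #|` translate t A| = #|` A|.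
Proof. by rewrite card_imfset //; apply: addIr. Qed.

Lemma card_zint_shift (c t : int) :
  #|` zint (c + 1) (c + t)| = #|` zint 1 t|.
Proof.
rewrite -(card_translate c (zint 1 t)); congr #|` _|.
by apply/fsetP => x; rewrite mem_translate !in_zint; lia.
Qed.

(** * Counting sums and differences after an insertion *)

(* Opens a gap of length [t] just above [c] and fills it. *)
Definition widen (c t : int) (A : {fset int}) : {fset int} :=
  zint (c + 1) (c + t) `|` [fset (if x <= c then x else x + t) | x in A].

Lemma mem_widen (c t : int) (A : {fset int}) (x : int) : 0 <= t ->
  (x \in widen c t A) =
  [|| c + 1 <= x <= c + t, (x <= c) && (x \in A) |
      (c + t < x) && ((x - t : int) \in A)].
Proof.
move=> t0; rewrite /widen in_fsetU in_zint; congr (_ || _).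
apply/imfsetP/idP => [[y yA ->] | ].
  case: ifP => yc; first by rewrite yc yA.
  have -> : y + t <= c = false by lia.
  have -> : c + t < y + t by lia.
  by rewrite addrK yA.
case/orP=> /andP[xc xA]; first by exists x; rewrite ?xc.
exists (x - t) => //; have -> : x - t <= c = false by lia.
by rewrite subrK.
Qed.

Lemma card_widen (c t : int) (A : {fset int}) : 0 <= t ->
  #|` widen c t A| = (#|` zint 1 t| + #|` A|)%N.
Proof.
move=> t0; rewrite cardfsU (_ : _ `&` _ = fset0) ?cardfs0 ?subn0.
  rewrite card_zint_shift card_imfset // => x y.
  by case: ifP; case: ifP; lia.
apply/fsetP => x; rewrite in_fsetI in_zint in_fset0.
apply/negP => /andP[xc /imfsetP[y _ yE]].
by move: yE xc; case: ifP; lia.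
Qed.

(** Both counts go through [widen] with a gap of length [2 * t]: the widened old sumset embeds in
    the new sumset, and the new difference set, translated by [t], embeds in the widened old
    difference set. *)
Lemma MSTD_insert (n a t : int) (L R M : {fset int}) :
  a <= n -> 0 <= t ->
  L `<=` zint a n -> R `<=` zint (n + 1) (2 * n + 1 - a) ->
  M `<=` zint (n + 1) (n + t) ->
  zint (- (n - a)) (n - a) `<=` diffset (L `|` R) ->
  zint (n + a + 1) (3 * n + 2 * t - a + 1)
    `<=` sumset (L `|` M `|` translate t R) ->
  MSTD (L `|` R) -> MSTD (L `|` M `|` translate t R).
Proof.
move=> an t0 /fsubset_intP Lsub /fsubset_intP Rsub /fsubset_intP Msub.
move=> /fsubset_intP diffE /fsubset_intP sumE mstd.
have {}Lsub (x : int) : x \in L -> a <= x <= n by move/Lsub; rewrite in_zint.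
have {}Rsub (x : int) : x \in R -> n + 1 <= x <= 2 * n + 1 - a.
  by move/Rsub; rewrite in_zint.
have {}Msub (x : int) : x \in M -> n + 1 <= x <= n + t.
  by move/Msub; rewrite in_zint.
set A := L `|` R in diffE mstd *; set A' := _ `|` translate t R in sumE *.
have inA (x : int) : (x \in A) = (x \in L) || (x \in R) by rewrite in_fsetU.
have inA' (x : int) : (x \in A') = [|| x \in L, x \in M | (x - t : int) \in R].
  by rewrite !in_fsetU mem_translate orbA.
have t20 : 0 <= 2 * t by lia.
have lower : (#|` zint 1 (2 * t)| + #|` sumset A| <= #|` sumset A'|)%N.
  rewrite -(card_widen (n + a) _ _ t20).
  apply/fsubset_leq_card/fsubset_intP => z.
  rewrite mem_widen // => /or3P[zmid | /andP[zlow] | /andP[zhigh]].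
  - by apply: sumE; rewrite in_zint; lia.
  (* Both summands are at least [a], hence at most [n], so they lie in [L]. *)
  - case/sumsetP=> x; rewrite !inA => xA yA.
    have := Lsub x; have := Lsub (z - x); have := Rsub x; have := Rsub (z - x).
    by move=> h1 h2 h3 h4; apply/sumsetP; exists x; rewrite inA'; lia.
  - case/sumsetP=> x; rewrite !inA => xA yA.
    case: (leP z (3 * n + 2 * t - a + 1)) => zmid.
      by apply: sumE; rewrite in_zint; lia.
    (* Past the middle interval both old summands exceed [n], so they lie in [R] and each moves up
       by [t]. *)
    have [y yE] : exists y : int, y = z - 2 * t - x by exists (z - 2 * t - x).
    rewrite -yE in yA.
    have := Lsub x; have := Rsub x; have := Lsub y; have := Rsub y.
    move=> h1 h2 h3 h4; apply/sumsetP; exists (x + t); rewrite inA'.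
      by rewrite addrK; lia.
    have -> : z - (x + t) - t = y :> int by lia.
    by lia.
have upper : (#|` diffset A'| <= #|` zint 1 (2 * t)| + #|` diffset A|)%N.
  rewrite -(card_widen (- (n - a) - 1) _ _ t20).
  (* A new difference [d] sits at [z = d + t]. If [d < -(n - a) - t], then [d + t = z] is an old
     difference; if [d > n - a + t], then [d - t = z - 2 * t] is one. The translation thus leaves a
     single gap of length [2 * t]. *)
  rewrite -(card_translate t (diffset A')).
  apply/fsubset_leq_card/fsubset_intP => z.
  rewrite mem_widen // mem_translate => /diffsetP[y].
  rewrite !inA' => yA xA.
  case: (leP z (- (n - a) - 1)) => zlow /=.
    have -> /= : z \in diffset A; last by lia.
    apply/diffsetP; exists (y - t); rewrite inA.
      have := Lsub y; have := Rsub (y - t); have := Msub y.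
      have := Lsub (z - t + y); have := Rsub (z - t + y - t).
      by have := Msub (z - t + y); lia.
    have -> : z + (y - t) = z - t + y :> int by lia.
    have := Lsub y; have := Rsub (y - t); have := Msub y.
    have := Lsub (z - t + y); have := Rsub (z - t + y - t).
    by have := Msub (z - t + y); lia.
  case: (leP z (- (n - a) - 1 + 2 * t)) => zmid /=; first by lia.
  have -> : z - 2 * t \in diffset A; last by lia.
  case: (leP z (n - a + 2 * t)) => zhigh.
    by apply: diffE; rewrite in_zint; lia.
  have := Lsub y; have := Rsub (y - t); have := Msub y.
  have := Lsub (z - t + y); have := Rsub (z - t + y - t).
  have := Msub (z - t + y) => h1 h2 h3 h4 h5 h6.
  apply/diffsetP; exists y; rewrite inA; first by lia.
  have -> : z - 2 * t + y = z - t + y - t :> int by lia.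
  by lia.
apply: leq_trans _ lower; apply: leq_ltn_trans upper _.
by rewrite ltn_add2l.
Qed.

(** The first starting point of the chain that is at least [w] works: either it opens the chain and
    is at most [p], or its predecessor is below [w] and at most [d] away. *)
Lemma chain_window (l d : int) (M I J : {fset int}) (p q w : int) :
  has_run_chain l d M I J ->
  (forall x : int, run l x `<=` I -> x <= p) ->
  (forall x : int, run l x `<=` J -> q <= x) ->
  p - d + 1 <= w <= q ->
  exists2 x : int, w <= x <= w + d - 1 & run l x `<=` M.
Proof.
case=> x [s [sM chain xI lJ]] hp hq wb.
move/hp: xI => xp; move/hq: lJ => {hp hq} ql.
(* Invariants of the induction along the chain: the current start is below [w + d] and the last one
   is at least [w]. *)
have : x <= w + d - 1 by lia.
have {wb ql xp} : w <= last x s by lia.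
elim: s x sM chain => [|u s IH] x sM /= chain wl xw.
  by exists x; [lia | apply: sM; rewrite inE].
case/andP: chain => xu us; case: (leP w x) => wx.
  by exists x; [lia | apply: sM; rewrite inE eqxx].
apply: (IH u) => //; last by lia.
by move=> y ys; apply: sM; rewrite inE ys orbT.
Qed.

(** * Sums covering the middle interval *)

(* The elements of [A1'] known a priori below the middle part [M1]; the mirror
   images [N + 1 - x] of these are those above it.  Likewise for [triple_low]
   and [A2']. *)
Definition pair_low (n k x : int) : bool :=
  [|| 1 <= x <= 4, x == n, x == n + 4,
      (n + 5 <= x <= n + 2 * k + 1) && (2 %| x - (n + 5))%Z |
      x == n + 2 * k + 2].

Definition triple_low (n k x : int) : bool :=
  [|| 5 <= x <= 7, n + 1 <= x <= n + 3,
      (n + 6 <= x <= n + 2 * k) && (2 %| x - (n + 6))%Z |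
      n + 2 * k + 3 <= x <= n + 2 * k + 5].

(** [P] stands for membership in [A1']; keeping it abstract lets the lemma serve for the mirror
    image too. Parity of [z] mostly decides which summand to take, and the ends of each range are
    treated apart. *)
Lemma pair_half_sums (n m k : int) (P : int -> bool) :
  n + 4 <= 2 * k -> 6 <= k -> 8 <= n ->
  (forall x : int, pair_low n k x -> P x) ->
  (forall x : int, pair_low n k (2 * n + m + 4 * k + 5 - x) -> P x) ->
  (forall w : int, n + 2 * k + 2 <= w <= n + m + 4 ->
     exists2 x : int, w <= x <= w + 2 * k - 2 & P x && P (x + 1)) ->
  forall z : int, n + 2 <= z <= 2 * n + m + 4 * k + 5 ->
  exists2 x : int, P x & P (z - x).
Proof.
rewrite /pair_low => kn k6 n8 low high win z zb.
have use (x : int) : P x -> P (z - x) -> exists2 x : int, P x & P (z - x).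
  by exists x.
have par : (2 %| z)%Z \/ (2 %| z - 1)%Z by lia.
have parn : (2 %| z - n)%Z \/ (2 %| z - n - 1)%Z by lia.
case: (leP z (n + 2 * k + 6)) => z1.
  case: (leP z (n + 4)) => z11; first by apply: (use n); apply: low; lia.
  case: (leP z (n + 8)) => z12; first by apply: (use (n + 4)); apply: low; lia.
  case: (eqVneq z (n + 2 * k + 6)) => z13.
    by apply: (use (n + 2 * k + 2)); apply: low; lia.
  case: parn => parn; last by apply: (use (z - 4)); apply: low; lia.
  by apply: (use (z - 3)); apply: low; lia.
(* Here [n + 4 <= 2 * k] gives [z >= 2 * n + 11], within O_11 + O_11. Even sums are two terms of the
   progression or a doubled endpoint, odd ones a term plus an endpoint. *)
case: (leP z (2 * n + 4 * k + 4)) => z2.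
  case: par => par.
    case: (eqVneq z (2 * n + 8)) => z21.
      by apply: (use (n + 4)); apply: low; lia.
    case: (eqVneq z (2 * n + 4 * k + 4)) => z22.
      by apply: (use (n + 2 * k + 2)); apply: low; lia.
    case: (leP z (2 * n + 2 * k + 6)) => z23.
      by apply: (use (n + 5)); apply: low; lia.
    by apply: (use (n + 2 * k + 1)); apply: low; lia.
  case: (leP z (2 * n + 2 * k + 5)) => z21.
    by apply: (use (n + 4)); apply: low; lia.
  by apply: (use (n + 2 * k + 2)); apply: low; lia.
case: (leP z (2 * n + m + 2 * k + 7)) => z3.
  (* This window puts [z - x] in [[n + 5, n + 2 * k + 3]], where every integer belongs to O_11 or
     follows an element of it. *)
  have [|x xb /andP[x1 x2]] := win (z - n - 2 * k - 3); first by lia.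
  case: (eqVneq (z - x) (n + 2 * k + 3)) => z31.
    by apply: (use (x + 1)) => //; apply: low; lia.
  case: (boolP ((2 %| z - x - n - 1)%Z || (z - x == n + 2 * k + 2))) => z32.
    by apply: (use x) => //; apply: low; lia.
  by apply: (use (x + 1)) => //; apply: low; lia.
(* The progression of O_12 has the parity of [n + m], which decides between [n + 4] and [n + 5]. *)
case: (boolP (2 %| z - m)%Z) => parm.
  by apply: (use (n + 4)); [apply: low | apply: high]; lia.
by apply: (use (n + 5)); [apply: low | apply: high]; lia.
Qed.

Lemma triple_half_sums (n m k : int) (P : int -> bool) :
  n + 4 <= 2 * k -> 6 <= k -> 8 <= n ->
  (forall x : int, triple_low n k x -> P x) ->
  (forall x : int, triple_low n k (2 * n + m + 4 * k + 5 - x) -> P x) ->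
  (forall w : int, n + 2 * k - 1 <= w <= n + m ->
     exists2 x : int, w <= x <= w + 2 * k + 4
       & [&& P x, P (x + 1) & P (x + 2)]) ->
  forall z : int, n + 6 <= z <= 2 * n + m + 4 * k + 5 ->
  exists2 x : int, P x & P (z - x).
Proof.
rewrite /triple_low => kn k6 n8 low high win z zb.
have use (x : int) : P x -> P (z - x) -> exists2 x : int, P x & P (z - x).
  by exists x.
have par : (2 %| z)%Z \/ (2 %| z - 1)%Z by lia.
have parn : (2 %| z - n)%Z \/ (2 %| z - n - 1)%Z by lia.
case: (leP z (n + 2 * k + 12)) => z1.
  case: (leP z (n + 8)) => z11; first by apply: (use (n + 1)); apply: low; lia.
  case: (leP z (n + 10)) => z12; first by apply: (use (n + 3)); apply: low; lia.
  case: (leP (n + 2 * k + 11) z) => z13.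
    by apply: (use (n + 2 * k + 5)); apply: low; lia.
  case: (leP (n + 2 * k + 8) z) => z14.
    by apply: (use (n + 2 * k + 3)); apply: low; lia.
  case: parn => parn; first by apply: (use (z - 6)); apply: low; lia.
  case: (eqVneq z (n + 2 * k + 7)) => z15.
    by apply: (use (z - 7)); apply: low; lia.
  by apply: (use (z - 5)); apply: low; lia.
case: (leP z (2 * n + 4 * k + 10)) => z2.
  (* The blocks of three at the two ends of O_21 contain both parities: the lower one plus the
     progression gives the small sums, the two blocks together the next ones, and the upper one the
     rest. *)
  case: (leP z (2 * n + 2 * k + 3)) => z21.
    case: par => par; first by apply: (use (n + 2)); apply: low; lia.
    case: (eqVneq z (2 * n + 2 * k + 3)) => z22.
      by apply: (use (n + 3)); apply: low; lia.
    by apply: (use (n + 1)); apply: low; lia.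
  case: (leP z (2 * n + 2 * k + 6)) => z22.
    by apply: (use (n + 1)); apply: low; lia.
  case: (leP z (2 * n + 2 * k + 8)) => z23.
    by apply: (use (n + 3)); apply: low; lia.
  case: (leP (2 * n + 4 * k + 9) z) => z24.
    by apply: (use (n + 2 * k + 5)); apply: low; lia.
  case: (leP (2 * n + 4 * k + 6) z) => z25.
    by apply: (use (n + 2 * k + 3)); apply: low; lia.
  case: par => par; first by apply: (use (n + 2 * k + 4)); apply: low; lia.
  case: (eqVneq z (2 * n + 4 * k + 5)) => z26.
    by apply: (use (n + 2 * k + 5)); apply: low; lia.
  by apply: (use (n + 2 * k + 3)); apply: low; lia.
case: (leP z (2 * n + m + 2 * k + 7)) => z3.
  (* Now [z - x] lies in [[n + 3, n + 2 * k + 7]], where O_21 never misses three integers in a row,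
     so one of [z - x], [z - x - 1], [z - x - 2] belongs to it. *)
  have [|x xb /and3P[x1 x2 x3]] := win (z - n - 2 * k - 7); first by lia.
  have : [|| z - x == n + 3, (2 %| z - x - n)%Z && (n + 6 <= z - x <= n + 2 * k)
           | n + 2 * k + 3 <= z - x <= n + 2 * k + 5]
       \/ [|| z - x == n + 4,
            (2 %| z - x - n - 1)%Z && (n + 7 <= z - x <= n + 2 * k + 1)
           | z - x == n + 2 * k + 6]
       \/ [|| z - x == n + 5, z - x == n + 2 * k + 2 | z - x == n + 2 * k + 7].
    by lia.
  case=> [h|[h|h]].
  - by apply: (use x) => //; apply: low; lia.
  - by apply: (use (x + 1)) => //; apply: low; lia.
  - by apply: (use (x + 2)) => //; apply: low; lia.
case: (leP (2 * n + m + 4 * k + 3) z) => z4.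
  by apply: (use (n + 1)); [apply: low | apply: high]; lia.
case: (boolP (2 %| z - m)%Z) => parm.
  case: (eqVneq z (2 * n + m + 4 * k + 2)) => z41.
    by apply: (use (n + 3)); [apply: low | apply: high]; lia.
  by apply: (use (n + 1)); [apply: low | apply: high]; lia.
by apply: (use (n + 2)); [apply: low | apply: high]; lia.
Qed.

(** Above [S = N + 1] the half lemma is applied to [fun x => P (S - x)]: reflection exchanges [low]
    and [high], preserves the range of [w] and sends [z] to [2 * S - z]. *)
Lemma pair_sums (n m k : int) (P : int -> bool) :
  n + 4 <= 2 * k -> 6 <= k -> 8 <= n ->
  (forall x : int, pair_low n k x -> P x) ->
  (forall x : int, pair_low n k (2 * n + m + 4 * k + 5 - x) -> P x) ->
  (forall w : int, n + 2 * k + 2 <= w <= n + m + 4 ->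
     exists2 x : int, w <= x <= w + 2 * k - 2 & P x && P (x + 1)) ->
  forall z : int, n + 2 <= z <= 3 * n + 2 * m + 8 * k + 8 ->
  exists2 x : int, P x & P (z - x).
Proof.
move=> kn k6 n8 low high win z zb.
case: (leP z (2 * n + m + 4 * k + 5)) => zhalf.
  by apply: (pair_half_sums n m k) => //; lia.
pose S := 2 * n + m + 4 * k + 5.
have lowS (x : int) : pair_low n k x -> P (S - x).
  by move=> xlow; apply: high; rewrite subKr.
have highS (x : int) : pair_low n k (S - x) -> P (S - x) by apply: low.
have winS (w : int) : n + 2 * k + 2 <= w <= n + m + 4 ->
    exists2 x : int, w <= x <= w + 2 * k - 2 & P (S - x) && P (S - (x + 1)).
  (* A pair starting at [x] reflects to one starting at [S - 1 - x], so the window to search starts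
     at [S - 1 - (w + 2 * k - 2)]. *)
  move=> wb; have [|x xb /andP[x1 x2]] := win (2 * n + m + 2 * k + 6 - w).
    by lia.
  exists (S - 1 - x); first by lia.
  have -> : S - (S - 1 - x) = x + 1 :> int by lia.
  have -> : S - (S - 1 - x + 1) = x :> int by lia.
  by rewrite x1 x2.
have [|x xP yP] := pair_half_sums n m k _ kn k6 n8 lowS highS winS (2 * S - z).
  by lia.
exists (S - x) => //; have -> // : z - (S - x) = S - (2 * S - z - x) :> int.
by lia.
Qed.

Lemma triple_sums (n m k : int) (P : int -> bool) :
  n + 4 <= 2 * k -> 6 <= k -> 8 <= n ->
  (forall x : int, triple_low n k x -> P x) ->
  (forall x : int, triple_low n k (2 * n + m + 4 * k + 5 - x) -> P x) ->
  (forall w : int, n + 2 * k - 1 <= w <= n + m ->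
     exists2 x : int, w <= x <= w + 2 * k + 4
       & [&& P x, P (x + 1) & P (x + 2)]) ->
  forall z : int, n + 6 <= z <= 3 * n + 2 * m + 8 * k + 4 ->
  exists2 x : int, P x & P (z - x).
Proof.
move=> kn k6 n8 low high win z zb.
case: (leP z (2 * n + m + 4 * k + 5)) => zhalf.
  by apply: (triple_half_sums n m k) => //; lia.
pose S := 2 * n + m + 4 * k + 5.
have lowS (x : int) : triple_low n k x -> P (S - x).
  by move=> xlow; apply: high; rewrite subKr.
have highS (x : int) : triple_low n k (S - x) -> P (S - x) by apply: low.
have winS (w : int) : n + 2 * k - 1 <= w <= n + m ->
    exists2 x : int, w <= x <= w + 2 * k + 4
      & [&& P (S - x), P (S - (x + 1)) & P (S - (x + 2))].
  move=> wb; have [|x xb /and3P[x1 x2 x3]] := win (2 * n + m + 2 * k - 1 - w).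
    by lia.
  exists (S - 2 - x); first by lia.
  have -> : S - (S - 2 - x) = x + 2 :> int by lia.
  have -> : S - (S - 2 - x + 1) = x + 1 :> int by lia.
  have -> : S - (S - 2 - x + 2) = x :> int by lia.
  by rewrite x1 x2 x3.
have [|x xP yP] :=
  triple_half_sums n m k _ kn k6 n8 lowS highS winS (2 * S - z).
  by lia.
exists (S - x) => //; have -> // : z - (S - x) = S - (2 * S - z - x) :> int.
by lia.
Qed.
Theorem theorem1p1
  (n : int) (A1 A2 L1 L2 R1 R2 : {fset int})
  (n_gt0 : 0 < n)
  (mstd1 : MSTD A1) (mstd2 : MSTD A2)
  (P1 : isP n A1) (P2 : isP (n - 4) A2)
  (disj12 : A1 `&` A2 = fset0) (cover12 : A1 `|` A2 = zint 1 (2 * n))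
  (A1E : A1 = L1 `|` R1) (A2E : A2 = L2 `|` R2)
  (L1sub : L1 `<=` zint 1 n) (R1sub : R1 `<=` zint (n + 1) (2 * n))
  (L2sub : L2 `<=` zint 1 n) (R2sub : R2 `<=` zint (n + 1) (2 * n))
  (L1sup : zint 1 4 `|` [fset n] `<=` L1)
  (R1sup : [fset n + 1] `|` zint (2 * n - 3) (2 * n) `<=` R1)
  (L2sup : zint 5 7 `<=` L2)
  (R2sup : zint (2 * n - 6) (2 * n - 4) `<=` R2)
  (k m : int)
  (k_ge : n%:~R / 2%:R + 2%:R <= k%:~R :> rat) (m_ge0 : 0 <= m)
  (M1 M2 : {fset int})
  (M1sub : M1 `<=` zint (n + 2 * k + 6) (n + m + 2 * k - 1))
  (M1pairs : has_run_chain 2 (2 * k - 1) M1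
               (zint (n + 2 * k + 6) (n + 4 * k + 1))
               (zint (n + m + 4) (n + m + 2 * k - 1)))
  (M2sub : M2 `<=` zint (n + 2 * k + 6) (n + m + 2 * k - 1))
  (M2triplets : has_run_chain 3 (2 * k + 5) M2
                  (zint (n + 2 * k + 6) (n + 4 * k + 5))
                  (zint (n + m) (n + m + 2 * k - 1)))
  (disjM : M1 `&` M2 = fset0)
  (coverM : M1 `|` M2 = zint (n + 2 * k + 6) (n + m + 2 * k - 1)) :
  let R1' := translate (m + 4 * k + 4) R1 in
  let R2' := translate (m + 4 * k + 4) R2 in
  let O11 := [fset n + 4] `|` zint2 (n + 5) (n + 2 * k + 1)
             `|` [fset n + 2 * k + 2] in
  let O12 := [fset n + m + 2 * k + 3]
             `|` zint2 (n + m + 2 * k + 4) (n + m + 4 * k)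
             `|` [fset n + m + 4 * k + 1] in
  let O21 := zint (n + 1) (n + 3) `|` zint2 (n + 6) (n + 2 * k)
             `|` zint (n + 2 * k + 3) (n + 2 * k + 5) in
  let O22 := zint (n + m + 2 * k) (n + m + 2 * k + 2)
             `|` zint2 (n + m + 2 * k + 5) (n + m + 4 * k - 1)
             `|` zint (n + m + 4 * k + 2) (n + m + 4 * k + 4) in
  let A1' := L1 `|` O11 `|` M1 `|` O12 `|` R1' in
  let A2' := L2 `|` O21 `|` M2 `|` O22 `|` R2' in
  [/\ MSTD A1', MSTD A2',
      A1' `&` A2' = fset0 & A1' `|` A2' = zint 1 (2 * n + m + 4 * k + 4)].
Proof.

(* Pointwise form of the hypotheses *)
have kn : n + 4 <= 2 * k.
  have : (n + 4)%:~R <= (2 * k)%:~R :> rat by rewrite intrD intrM; lra.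
  by rewrite ler_int.
have inA (x : int) : (x \in A1) = (x \in L1) || (x \in R1).
  by rewrite A1E in_fsetU.
have inA' (x : int) : (x \in A2) = (x \in L2) || (x \in R2).
  by rewrite A2E in_fsetU.
have disj (x : int) : ~~ ((x \in A1) && (x \in A2)).
  by rewrite -in_fsetI disj12 in_fset0.
have cover (x : int) : (x \in A1) || (x \in A2) = (1 <= x <= 2 * n).
  by rewrite -in_fsetU cover12 in_zint.
have L1b (x : int) : x \in L1 -> 1 <= x <= n.
  by rewrite -in_zint; apply: (fsubset_intP _ _ L1sub).
have L2b (x : int) : x \in L2 -> 1 <= x <= n.
  by rewrite -in_zint; apply: (fsubset_intP _ _ L2sub).
have R1b (x : int) : x \in R1 -> n + 1 <= x <= 2 * n.
  by rewrite -in_zint; apply: (fsubset_intP _ _ R1sub).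
have R2b (x : int) : x \in R2 -> n + 1 <= x <= 2 * n.
  by rewrite -in_zint; apply: (fsubset_intP _ _ R2sub).
have M1b (x : int) : x \in M1 -> n + 2 * k + 6 <= x <= n + m + 2 * k - 1.
  by rewrite -in_zint; apply: (fsubset_intP _ _ M1sub).
have M2b (x : int) : x \in M2 -> n + 2 * k + 6 <= x <= n + m + 2 * k - 1.
  by rewrite -in_zint; apply: (fsubset_intP _ _ M2sub).
have L1c (x : int) : (1 <= x <= 4) || (x == n) -> x \in L1.
  by move=> h; apply: (fsubset_intP _ _ L1sup);
  rewrite in_fsetU in_zint in_fset1.
have L2c (x : int) : 5 <= x <= 7 -> x \in L2.
  by move=> h; apply: (fsubset_intP _ _ L2sup); rewrite in_zint.
have R1c (x : int) : (x == n + 1) || (2 * n - 3 <= x <= 2 * n) -> x \in R1.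
  by move=> h; apply: (fsubset_intP _ _ R1sup);
  rewrite in_fsetU in_zint in_fset1.
have R2c (x : int) : 2 * n - 6 <= x <= 2 * n - 4 -> x \in R2.
  by move=> h; apply: (fsubset_intP _ _ R2sup); rewrite in_zint.
have disjM' (x : int) : ~~ ((x \in M1) && (x \in M2)).
  by rewrite -in_fsetI disjM in_fset0.
have coverM' (x : int) :
    (x \in M1) || (x \in M2) = (n + 2 * k + 6 <= x <= n + m + 2 * k - 1).
  by rewrite -in_fsetU coverM in_zint.
clear k_ge L1sub L2sub R1sub R2sub M1sub M2sub L1sup L2sup R1sup R2sup.

(* Lower bounds on the parameters *)
have n7 : n != 7.
  have nL1 : n \in L1 by apply: L1c; rewrite eqxx orbT.
  apply/eqP => nE; have := disj n.
  by rewrite inA inA' nL1 nE L2c.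
have n8 : 8 <= n.
  by have := L2b 7 (L2c 7 isT); lia.
have k6 : 6 <= k by lia.
(* [M2] contains a triplet, so the interval around it has at least three elements; this keeps O_i1
   and O_i2 apart. *)
have m8 : 8 <= m.
  case: M2triplets => x [s [/(_ x) + _ _ _]].
  rewrite inE eqxx => /(_ isT)/fsubset_intP xM.
  have := M2b x; have := M2b (x + 2).
  by rewrite !xM ?in_zint; lia.

(* The enlarged sets and their known elements *)
move=> R1' R2' O11 O12 O21 O22 A1' A2'.
have inA1' (x : int) : (x \in A1') =
    [|| x \in L1, x \in O11, x \in M1, x \in O12 |
        (x - (m + 4 * k + 4) : int) \in R1].
  by rewrite /A1' /R1' !in_fsetU mem_translate -!orbA.
have inA2' (x : int) : (x \in A2') =
    [|| x \in L2, x \in O21, x \in M2, x \in O22 |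
        (x - (m + 4 * k + 4) : int) \in R2].
  by rewrite /A2' /R2' !in_fsetU mem_translate -!orbA.
have inO11 (x : int) : (x \in O11) = [|| x == n + 4,
    (n + 5 <= x <= n + 2 * k + 1) && (2 %| x - (n + 5))%Z | x == n + 2 * k + 2].
  by rewrite /O11 !in_fsetU !in_fset1 mem_zint2 -!orbA.
have inO12 (x : int) : (x \in O12) = [|| x == n + m + 2 * k + 3,
    (n + m + 2 * k + 4 <= x <= n + m + 4 * k)
      && (2 %| x - (n + m + 2 * k + 4))%Z | x == n + m + 4 * k + 1].
  by rewrite /O12 !in_fsetU !in_fset1 mem_zint2 -!orbA.
have inO21 (x : int) : (x \in O21) = [|| n + 1 <= x <= n + 3,
    (n + 6 <= x <= n + 2 * k) && (2 %| x - (n + 6))%Z |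
    n + 2 * k + 3 <= x <= n + 2 * k + 5].
  by rewrite /O21 !in_fsetU !in_zint mem_zint2 -!orbA.
have inO22 (x : int) : (x \in O22) = [||
    n + m + 2 * k <= x <= n + m + 2 * k + 2,
    (n + m + 2 * k + 5 <= x <= n + m + 4 * k - 1)
      && (2 %| x - (n + m + 2 * k + 5))%Z |
    n + m + 4 * k + 2 <= x <= n + m + 4 * k + 4].
  by rewrite /O22 !in_fsetU !in_zint mem_zint2 -!orbA.
have A1'E : A1' = L1 `|` (O11 `|` M1 `|` O12) `|` translate (m + 4 * k + 4) R1.
  by rewrite /A1' !fsetUA.
have A2'E : A2' = L2 `|` (O21 `|` M2 `|` O22) `|` translate (m + 4 * k + 4) R2.
  by rewrite /A2' !fsetUA.
clearbody O11 O12 O21 O22 A1' A2'.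
have O1b (x : int) : [|| x \in O11, x \in M1 | x \in O12] ->
    n + 1 <= x <= n + m + 4 * k + 4.
  by rewrite inO11 inO12; have := M1b x; lia.
(* The inserted parts are complementary in the gap, as seen separately on the stretches of O_i1, M_i
   and O_i2. *)
have Opart (x : int) :
    [|| x \in O21, x \in M2 | x \in O22] =
    (n + 1 <= x <= n + m + 4 * k + 4)
      && ~~ [|| x \in O11, x \in M1 | x \in O12].
  case: (leP x (n + 2 * k + 5)) => xlow.
    have -> : x \in M1 = false by have := M1b x; lia.
    have -> : x \in M2 = false by have := M2b x; lia.
    have -> : x \in O12 = false by rewrite inO12; lia.
    have -> : x \in O22 = false by rewrite inO22; lia.
    by rewrite inO11 inO21; lia.
  have -> : x \in O11 = false by rewrite inO11; lia.
  have -> : x \in O21 = false by rewrite inO21; lia.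
  case: (leP x (n + m + 2 * k - 1)) => xhigh.
    have -> : x \in O12 = false by rewrite inO12; lia.
    have -> : x \in O22 = false by rewrite inO22; lia.
    by have := disjM' x; have := coverM' x; lia.
  have -> : x \in M1 = false by have := M1b x; lia.
  have -> : x \in M2 = false by have := M2b x; lia.
  by rewrite inO12 inO22; lia.
have low1 (x : int) : pair_low n k x -> x \in A1'.
  rewrite /pair_low inA1' inO11; have := L1c x.
  by lia.
have high1 (x : int) : pair_low n k (2 * n + m + 4 * k + 5 - x) -> x \in A1'.
  rewrite /pair_low inA1' inO12; have := R1c (x - (m + 4 * k + 4)).
  by lia.
have low2 (x : int) : triple_low n k x -> x \in A2'.
  rewrite /triple_low inA2' inO21; have := L2c x.
  by lia.
have high2 (x : int) : triple_low n k (2 * n + m + 4 * k + 5 - x) -> x \in A2'.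
  rewrite /triple_low inA2' inO22; have := R2c (x - (m + 4 * k + 4)).
  by lia.
have win1 (w : int) : n + 2 * k + 2 <= w <= n + m + 4 ->
    exists2 x : int, w <= x <= w + 2 * k - 2 & (x \in A1') && (x + 1 \in A1').
  (* [n + 4 * k] is the largest start of a pair inside the first prescribed interval, [n + m + 4]
     the smallest inside the last. *)
  move=> wb; have [x|x||x xb /fsubset_intP xM] :=
    chain_window _ _ _ _ _ (n + 4 * k) (n + m + 4) w M1pairs.
  - by move/fsubset_intP/(_ (x + 1)); rewrite !in_zint; lia.
  - by move/fsubset_intP/(_ x); rewrite !in_zint; lia.
  - by lia.
  by exists x; [lia | rewrite !inA1' !xM ?in_zint ?orbT //; lia].
have win2 (w : int) : n + 2 * k - 1 <= w <= n + m ->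
    exists2 x : int, w <= x <= w + 2 * k + 4
      & [&& x \in A2', x + 1 \in A2' & x + 2 \in A2'].
  move=> wb; have [x|x||x xb /fsubset_intP xM] :=
    chain_window _ _ _ _ _ (n + 4 * k + 3) (n + m) w M2triplets.
  - by move/fsubset_intP/(_ (x + 2)); rewrite !in_zint; lia.
  - by move/fsubset_intP/(_ x); rewrite !in_zint; lia.
  - by lia.
  by exists x; [lia | rewrite !inA2' !xM ?in_zint ?orbT //; lia].
have sub1 (x : int) : x \in A1 -> 1 <= x <= 2 * n.
  by rewrite inA => /orP[/L1b|/R1b]; lia.
(* The four integers at each end of [[1, 2n]] belong to [A1]. *)
have sub2 (x : int) : x \in A2 -> 5 <= x <= 2 * n - 4.
  rewrite inA'; have := disj x; rewrite inA inA'.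
  have := L2b x; have := R2b x; have := L1c x; have := R1c x.
  by lia.

(* The partition *)
have part (x : int) : (x \in A1') && (x \in A2') = false
    /\ (x \in A1') || (x \in A2') = (1 <= x <= 2 * n + m + 4 * k + 4).
  have -> : (x \in A1') =
      [|| x \in L1, [|| x \in O11, x \in M1 | x \in O12] |
          (x - (m + 4 * k + 4) : int) \in R1].
    by rewrite inA1' -!orbA.
  have -> : (x \in A2') =
      [|| x \in L2, [|| x \in O21, x \in M2 | x \in O22] |
          (x - (m + 4 * k + 4) : int) \in R2].
    by rewrite inA2' -!orbA.
  (* Up to [n] the old partition is used at [x], in the gap [o] alone decides, and above the gap the
     old partition is used at [y]. *)
  rewrite Opart; set o := [|| x \in O11, _ | _].
  have ob : o -> n + 1 <= x <= n + m + 4 * k + 4 := O1b x.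
  clearbody o; have [y yE] : exists y : int, y = x - (m + 4 * k + 4) by eexists.
  rewrite -yE; have := L1b x; have := L2b x; have := R1b y; have := R2b y.
  case: (leP x n) => xlow.
    have -> : o = false by lia.
    move=> h1 h2; have -> : y \in R1 = false by lia.
    have -> : y \in R2 = false by lia.
    have := disj x; have := cover x; rewrite inA inA'.
    have -> : x \in R1 = false by have := R1b x; lia.
    have -> : x \in R2 = false by have := R2b x; lia.
    by case: (x \in L1); case: (x \in L2); lia.
  move=> h1 h2 h3 h4.
  have -> : x \in L1 = false by lia.
  have -> : x \in L2 = false by lia.
  case: (leP x (n + m + 4 * k + 4)) => xhigh.
    have -> : y \in R1 = false by lia.
    have -> : y \in R2 = false by lia.
    by clear h1 h2 h3 h4; case: o {ob}; lia.
  have -> : o = false by lia.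
  have := disj y; have := cover y; rewrite inA inA'.
  have -> : y \in L1 = false by have := L1b y; lia.
  have -> : y \in L2 = false by have := L2b y; lia.
  by move: h1 h2; case: (y \in R1); case: (y \in R2); lia.

(* The MSTD property of both sets *)
split.
- rewrite A1'E; apply: (MSTD_insert n 1); rewrite -?A1'E -?A1E //.
  + by lia.
  + by apply/fsubset_intP => x /L1b; rewrite in_zint; lia.
  + by apply/fsubset_intP => x /R1b; rewrite in_zint; lia.
  + apply/fsubset_intP => x; rewrite !in_fsetU in_zint -orbA => xO.
    have := O1b x xO; by lia.
  + case: P1 => a [b [[aA amin] [bA bmax] _]].
    have -> : a = 1.
      have := sub1 _ aA; have := amin 1; rewrite inA L1c // => /(_ isT).
      by lia.
    have -> : b = 2 * n.
      have := sub1 _ bA; have := bmax (2 * n).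
      rewrite inA orbC R1c; last by lia.
      by move=> /(_ isT); lia.
    have -> : 1 - 2 * n + n = - (n - 1) :> int by lia.
    by have -> : 2 * n - 1 - n = n - 1 :> int by lia.
  apply/fsubset_intP => z; rewrite in_zint => zb; apply/sumsetP.
  by apply: (pair_sums n m k) => //; lia.
- rewrite A2'E; apply: (MSTD_insert n 5); rewrite -?A2'E -?A2E //.
  + by lia.
  + by lia.
  + apply/fsubset_intP => x xL; rewrite in_zint.
    by have := L2b x xL; have := sub2 x; rewrite inA' xL; lia.
  + apply/fsubset_intP => x xR; rewrite in_zint.
    by have := R2b x xR; have := sub2 x; rewrite inA' xR orbT; lia.
  + apply/fsubset_intP => x; rewrite !in_fsetU in_zint -orbA => xO.
    by have := Opart x; rewrite xO => /esym/andP[]; lia.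
  (* The extremes [5] and [2 * n - 4] turn P_{n-4} into differences covering [[-(n - 5), n - 5]], as
     required for [a = 5]. *)
  + case: P2 => a [b [[aA amin] [bA bmax] _]].
    have -> : a = 5.
      have := sub2 _ aA; have := amin 5; rewrite inA' L2c // => /(_ isT).
      by lia.
    have -> : b = 2 * n - 4.
      have := sub2 _ bA; have := bmax (2 * n - 4).
      rewrite inA' orbC R2c; last by lia.
      by move=> /(_ isT); lia.
    have -> : 5 - (2 * n - 4) + (n - 4) = - (n - 5) :> int by lia.
    by have -> : 2 * n - 4 - 5 - (n - 4) = n - 5 :> int by lia.
  apply/fsubset_intP => z; rewrite in_zint => zb; apply/sumsetP.
  by apply: (triple_sums n m k) => //; lia.
- by apply/fsetP => x; rewrite in_fsetI in_fset0; have [-> _] := part x.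
by apply/fsetP => x; rewrite in_fsetU in_zint; have [_ ->] := part x.
Qed.
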